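(* Let $q$ be a prime power, $n\ge2$, $s\ge2$, $1\le k\le n-1$ integers, $\sigma$ a generator of $\mathrm{Gal}(\mathbb F_{q^n}/\mathbb F_q)$, and $F\in\mathbb F_q[Y]$ a monic irreducible polynomial of degree $s$. If $(n,s,F)\ne(2,2,Y^2-\nu)$ for every $\nu\in\mathbb F_q^\times$, then $$|\mathrm{Aut}_{\mathbb E_F}(\mathcal S_k(F))|=n\,\frac{(q^s-1)(q^n-1)^2}{q-1}.$$
   Context: $R=\mathbb F_{q^n}[X;\sigma]$ is the skew polynomial ring with $X\alpha=\sigma(\alpha)X$; its center is $\mathbb F_q[X^n]$. $RF(X^n)$ is a two-sided ideal, $R_F:=R/RF(X^n)$, and $\mathbb E_F:=Z(R_F)\cong\mathbb F_q[Y]/(F)\cong\mathbb F_{q^s}$; $R_F\cong M_n(\mathbb E_F)$ as $\mathbb E_F$-algebras. The code is $$\mathcal S_k(F):=\Big\{\sum_{i=0}^{sk-1}\alpha_iX^i+RF(X^n):\alpha_i\in\mathbb F_{q^n}\Big\}\subseteq R_F ,$$ and, under $R_F\cong M_n(\mathbb E_F)$, its linear automorphism group is $$\mathrm{Aut}_{\mathbb E_F}(\mathcal S_k(F)):=\{(\bar g,\bar h)\in R_F^\times\times R_F^\times:\ \bar g\,\mathcal S_k(F)\,\bar h=\mathcal S_k(F)\}.$$ *)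

(* Defs.v *)
From HB Require Import structures.
From mathcomp Require Import all_boot all_order all_fingroup all_algebra.
From mathcomp Require Import all_solvable all_field.
From mathcomp Require Import boolp zify.

Set Implicit Arguments.
Unset Strict Implicit.
Unset Printing Implicit Defensive.

Import GRing.Theory.
Local Open Scope ring_scope.
Local Open Scope quotient_scope.

Reserved Notation "{ 'skew' sigma }" (format "{ 'skew'  sigma }").
Reserved Notation "a %:S" (at level 1, left associativity, format "a %:S").

(* An element of L[X; sigma] is stored as the {poly L} of its left
   coefficients.  {skew sigma} shares the additive group of {poly L} but not
   its product, so the lemmas on the product of {poly L} do not apply to it. *)
Definition skewpoly (L : fieldType) (sigma : {rmorphism L -> L}) : Type :=
  {poly L}.

Notation "{ 'skew' sigma }" :=
  (skewpoly (sigma : {rmorphism _ -> _})) : type_scope.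

Section SkewRing.
Variables (L : fieldType) (sigma : {rmorphism L -> L}).

HB.instance Definition _ := GRing.Zmodule.copy (skewpoly sigma) {poly L}.

Implicit Types (p q r : skewpoly sigma) (a b : L).

Definition skew_mul p q : skewpoly sigma :=
  \poly_(i < (size (p : {poly L}) + size (q : {poly L})).-1)
     \sum_(j < i.+1)
        (p : {poly L})`_j * iter j sigma (q : {poly L})`_(i - j).

Definition skewC a : skewpoly sigma := a%:P.
Definition skewX : skewpoly sigma := 'X.

Lemma iter_sigma0 j : iter j sigma 0 = 0.
Proof. by elim: j => //= j ->; rewrite rmorph0. Qed.
Lemma iter_sigma1 j : iter j sigma 1 = 1.
Proof. by elim: j => //= j ->; rewrite rmorph1. Qed.
Lemma iter_sigmaD j : {morph iter j sigma : a b / a + b}.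
Proof. by move=> a b; elim: j => //= j ->; rewrite rmorphD. Qed.
Lemma iter_sigmaM j : {morph iter j sigma : a b / a * b}.
Proof. by move=> a b; elim: j => //= j ->; rewrite rmorphM. Qed.
Lemma iter_sigma_sum j (I : Type) (s : seq I) (P : pred I) (E : I -> L) :
  iter j sigma (\sum_(i <- s | P i) E i)
    = \sum_(i <- s | P i) iter j sigma (E i).
Proof. exact: (big_morph _ (iter_sigmaD j) (iter_sigma0 j)). Qed.
Lemma iter_sigma_eq0 j a : (iter j sigma a == 0) = (a == 0).
Proof. by elim: j => //= j IHj; rewrite fmorph_eq0. Qed.

Lemma coef_skew_mul p q i :
  (skew_mul p q : {poly L})`_i =
    \sum_(j < i.+1) (p : {poly L})`_j * iter j sigma (q : {poly L})`_(i - j).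
Proof.
rewrite /skew_mul coef_poly ltn_predRL; case: leqP => // le_pq_i1.
rewrite big1 // => j _.
have [lq_p_j|lt_j_p] := leqP (size (p : {poly L})) j.
  by rewrite nth_default ?mul0r.
rewrite [X in iter _ _ X]nth_default ?iter_sigma0 ?mulr0 //.
rewrite leq_subRL -ltnS //.
by rewrite (leq_trans _ le_pq_i1) // ltn_add2r.
Qed.

Lemma coef_skew_mul_rev p q i :
  (skew_mul p q : {poly L})`_i =
    \sum_(j < i.+1)
       (p : {poly L})`_(i - j) * iter (i - j) sigma (q : {poly L})`_j.
Proof.
rewrite coef_skew_mul (reindex_inj rev_ord_inj) /=.
by apply: eq_bigr => j _; rewrite subSS (sub_ordK j).
Qed.

Fact skew_mulA : associative skew_mul.
Proof.
move=> p q r; apply/polyP=> i; rewrite coef_skew_mul coef_skew_mul_rev.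
pose coef3 j k := (p : {poly L})`_j
  * (iter j sigma (q : {poly L})`_(i - j - k)
     * iter (i - k) sigma (r : {poly L})`_k).
transitivity (\sum_(j < i.+1) \sum_(k < i.+1 | (k <= i - j)%N) coef3 j k).
  apply: eq_bigr => /= j _.
  rewrite coef_skew_mul_rev iter_sigma_sum big_distrr /=.
  rewrite (big_ord_narrow_leq (leq_subr _ _)); apply: eq_bigr => k _ /=.
  rewrite /coef3 iter_sigmaM -iterD; congr (_ * (_ * iter _ _ _)).
  by have := leq_ord k; have := leq_ord j; lia.
rewrite (exchange_big_dep predT) //=; apply: eq_bigr => k _.
transitivity (\sum_(j < i.+1 | (j <= i - k)%N) coef3 j k).
  apply: eq_bigl => j; rewrite -ltnS -(ltnS j) -!subSn ?leq_ord //.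
  by rewrite -subn_gt0 -(subn_gt0 j) -!subnDA addnC.
rewrite (big_ord_narrow_leq (leq_subr _ _)) coef_skew_mul big_distrl /=.
by apply: eq_bigr => j _; rewrite /coef3 -!subnDA addnC mulrA.
Qed.

Fact skew_mul1p : left_id (skewC 1) skew_mul.
Proof.
move=> p; apply/polyP => i; rewrite coef_skew_mul big_ord_recl subn0 /=.
by rewrite big1 => [|j _]; rewrite coefC ?mul0r //= mul1r addr0.
Qed.

Fact skew_mulp1 : right_id (skewC 1) skew_mul.
Proof.
move=> p; apply/polyP => i; rewrite coef_skew_mul_rev big_ord_recl subn0 /=.
rewrite big1 => [|j _]; first by rewrite coefC /= iter_sigma1 mulr1 addr0.
by rewrite coefC /= iter_sigma0 mulr0.
Qed.

Fact skew_mulDl : left_distributive skew_mul +%R.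
Proof.
move=> p q r; apply/polyP=> i; rewrite coefD !coef_skew_mul -big_split.
by apply: eq_bigr => j _; rewrite coefD mulrDl.
Qed.

Fact skew_mulDr : right_distributive skew_mul +%R.
Proof.
move=> p q r; apply/polyP=> i; rewrite coefD !coef_skew_mul -big_split.
by apply: eq_bigr => j _; rewrite coefD iter_sigmaD mulrDr.
Qed.

Fact skew1_neq0 : skewC 1 != 0.
Proof. by rewrite polyC_eq0 oner_neq0. Qed.

HB.instance Definition _ := GRing.Zmodule_isNzRing.Build (skewpoly sigma)
  skew_mulA skew_mul1p skew_mulp1 skew_mulDl skew_mulDr skew1_neq0.

Lemma coef_skewM p q i :
  (p * q : {poly L})`_i =
    \sum_(j < i.+1) (p : {poly L})`_j * iter j sigma (q : {poly L})`_(i - j).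
Proof. exact: coef_skew_mul. Qed.

Lemma coef_skewCM a p i : ((skewC a * p : skewpoly sigma) : {poly L})`_i
  = a * (p : {poly L})`_i.
Proof.
rewrite coef_skewM big_ord_recl subn0 coefC /= big1 ?addr0 // => j _.
by rewrite coefC mul0r.
Qed.

Lemma coef_skewXM p i : ((skewX * p : skewpoly sigma) : {poly L})`_i
  = if i is j.+1 then sigma (p : {poly L})`_j else 0.
Proof.
rewrite coef_skewM; case: i => [|i].
  by rewrite big_ord_recl big_ord0 coefX mul0r addr0.
rewrite 2!big_ord_recl /= !coefX /= mul0r add0r mul1r subn1 /= big1 ?addr0 //.
by move=> j _; rewrite coefX mul0r.
Qed.

Lemma skewXC a : skewX * skewC a = skewC (sigma a) * skewX.
Proof.
apply/polyP => -[|i]; rewrite coef_skewXM coef_skewCM coefX ?mulr0 //=.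
by rewrite coefC eqSS; case: i => [|i] /=; rewrite ?mulr1 // rmorph0 mulr0.
Qed.

Lemma skewXn i : (skewX ^+ i : skewpoly sigma) = 'X^i :> {poly L}.
Proof.
elim: i => [|i IHi] //; rewrite exprS; apply/polyP => -[|j].
  by rewrite coef_skewXM coefXn.
by rewrite coef_skewXM IHi !coefXn eqSS rmorph_nat.
Qed.

Lemma coef_skew_mono a i j :
  ((skewC a * skewX ^+ i : skewpoly sigma) : {poly L})`_j = a *+ (j == i).
Proof. by rewrite coef_skewCM skewXn coefXn mulr_natr. Qed.

End SkewRing.
Notation "a %:S" := (skewC _ a) : ring_scope.

Section SkewQuotient.
Variables (Fq : finFieldType) (L : splittingFieldType Fq).
Variables (sigma : gal_of {:L}) (F : {poly Fq}).

Local Notation R := {skew sigma}.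
Local Notation n := (\dim {:L}).

Implicit Types p q r : R.

(* F(X^n), where n = [L : Fq]; the scalars of Fq act on L by c |-> c%:A. *)
Definition skewFXn : R :=
  \sum_(i < size F) (F`_i)%:A%:S * (skewX _ ^+ n) ^+ i.

Lemma iter_dim_id a : iter n sigma a = a.
Proof.
have -> m : iter m sigma a = (sigma ^+ m)%g a.
  by elim: m => [|m IHm]; rewrite ?gal_id // expgSr galM ?memvf // -IHm.
have : (sigma ^+ #|'Gal({:L} / 1%AS)| = 1)%g.
  by apply: expg_cardG; rewrite gal_kHom ?sub1v ?k1AHom.
rewrite -galois_dim ?finField_galois ?sub1v //.
by rewrite dimv1 divn1 => ->; rewrite gal_id.
Qed.

Lemma iter_dimM_id i a : iter (n * i) sigma a = a.
Proof. by elim: i => [|i IHi]; rewrite ?muln0 // mulnS iterD IHi iter_dim_id. Qed.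

Lemma iter_sigma_alg i (c : Fq) : iter i sigma c%:A = c%:A.
Proof. by elim: i => //= i ->; rewrite linearZ rmorph1. Qed.

Lemma n_gt0 : (0 < n)%N. Proof. exact: adim_gt0. Qed.

Lemma coef_skewFXn i :
  (skewFXn : {poly L})`_i = if (n %| i)%N then (F`_(i %/ n))%:A else 0.
Proof.
rewrite /skewFXn (big_morph (fun p : R => (p : {poly L})`_i)
  (id1 := 0) (op1 := +%R)); [|by move=> p q; rewrite coefD|by rewrite coef0].
under eq_bigr do rewrite -exprM coef_skew_mono.
case: ifPn => [/dvdnP [j ->]|ndvd]; last first.
  rewrite big1 // => j _; case: eqP => // ji; case/negP: ndvd.
  by rewrite ji dvdn_mulr.
rewrite mulnK ?n_gt0 //; have [lt_j|ge_j] := ltnP j (size F); last first.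
  rewrite nth_default // scale0r big1 // => l _; case: eqP => //.
  move/eqP; rewrite mulnC eqn_pmul2l ?n_gt0 // => /eqP jl.
  by have := ltn_ord l; rewrite -jl ltnNge ge_j.
rewrite (bigD1 (Ordinal lt_j)) //= mulnC eqxx big1 ?addr0 // => l.
rewrite eqn_pmul2l ?n_gt0 // => /negPf; rewrite -val_eqE /= eq_sym => ->.
by rewrite mulr0n.
Qed.

Lemma skewFXn_central p : p * skewFXn = skewFXn * p.
Proof.
apply/polyP => i.
have -> : (skewFXn * p : {poly L})`_i
  = \sum_(j < i.+1) (skewFXn : {poly L})`_(i - j) * (p : {poly L})`_j.
  rewrite [LHS]coef_skew_mul_rev; apply: eq_bigr => j _.
  rewrite coef_skewFXn; case: ifP => [/dvdnP [l ->]|_]; last by rewrite !mul0r.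
  by rewrite [(l * _)%N]mulnC iter_dimM_id.
rewrite coef_skewM; apply: eq_bigr => j _; rewrite mulrC; congr (_ * _).
by rewrite coef_skewFXn; case: ifP; rewrite ?iter_sigma_alg ?iter_sigma0.
Qed.

Local Notation d := (size F).-1.

Lemma skewFXn_coef_gt i : (n * d < i)%N -> (skewFXn : {poly L})`_i = 0.
Proof.
move=> lt_i; rewrite coef_skewFXn; case: ifP => // /dvdnP [j ij].
rewrite ij mulnK ?n_gt0 // nth_default ?scale0r //.
by move: lt_i; rewrite ij [(j * n)%N]mulnC ltn_pmul2l ?n_gt0 //; case: size.
Qed.

Lemma skewFXn_lead : (skewFXn : {poly L})`_(n * d) = (lead_coef F)%:A.
Proof. by rewrite coef_skewFXn dvdn_mulr // mulKn ?n_gt0. Qed.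

Lemma coef_mul_skewFXn p : p != 0 ->
  (p * skewFXn : {poly L})`_((size (p : {poly L})).-1 + n * d)
    = lead_coef (p : {poly L}) * (lead_coef F)%:A.
Proof.
move=> p0; set m := (size _).-1; rewrite coef_skewM.
have ltm : (m < (m + n * d).+1)%N by rewrite ltnS leq_addr.
rewrite (bigD1 (Ordinal ltm)) //= addKn skewFXn_lead iter_sigma_alg.
rewrite big1 ?addr0 // => j; rewrite -val_eqE /= neq_ltn => /orP[ltj|gtj].
  rewrite skewFXn_coef_gt ?iter_sigma0 ?mulr0 //.
  by rewrite -addnBAC ?(ltnW ltj) // -[X in (X < _)%N]add0n ltn_add2r subn_gt0.
rewrite nth_default ?mul0r //; apply: leq_trans gtj.
exact: leqSpred.
Qed.

Definition skewFXn_ideal : {pred R} :=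
  fun p => `[< exists r : R, p = r * skewFXn >].

Fact skewFXn_ideal_zmod : zmod_closed skewFXn_ideal.
Proof.
split=> [|p q /asboolP[r ->] /asboolP[t ->]]; apply/asboolP.
  by exists 0; rewrite mul0r.
by exists (r - t); rewrite mulrBl.
Qed.
HB.instance Definition _ :=
  GRing.isZmodClosed.Build R skewFXn_ideal skewFXn_ideal_zmod.

Lemma skewFXn_idealMl p q : q \in skewFXn_ideal -> p * q \in skewFXn_ideal.
Proof.
by move=> /asboolP[r ->]; apply/asboolP; exists (p * r); rewrite mulrA.
Qed.

Lemma skewFXn_idealMr p q : q \in skewFXn_ideal -> q * p \in skewFXn_ideal.
Proof.
move=> /asboolP[r ->]; apply/asboolP; exists (r * p).
by rewrite -!mulrA skewFXn_central.
Qed.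

(* The additive quotient is the library's; the product is the one induced by
   {skew sigma}, which is well defined because the left ideal generated by the
   central element F(X^n) is two-sided (see skewFXn_idealMr).
   Irreducibility of F is used here only through 1 < size F, which makes the
   quotient nontrivial. *)
Definition skew_quot (Firr : irreducible_poly F) : Type :=
  {ideal_quot skewFXn_ideal}.

Variable Firr : irreducible_poly F.
Local Notation RF := (skew_quot Firr).

HB.instance Definition _ := GRing.Zmodule.on RF.
HB.instance Definition _ : EqQuotient R (Quotient.equiv skewFXn_ideal) RF :=
  EqQuotient.on RF.

Lemma eq_skew_quotP p q :
  reflect (exists r : R, p - q = r * skewFXn) (p == q %[mod RF]).
Proof. by rewrite piE; apply: asboolP. Qed.

Definition skew_quot1 : RF := lift_cst RF 1.
Definition skew_quot_mul := lift_op2 RF *%R.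

Canonical pi_skew_quot1_morph := PiConst skew_quot1.

Lemma pi_skew_quot_mul : {morph \pi_RF : p q / p * q >-> skew_quot_mul p q}.
Proof.
move=> p q; unlock skew_quot_mul; apply/eqP/eq_skew_quotP/asboolP.
pose p' := generic_quotient.repr (\pi_RF p); pose q' := generic_quotient.repr (\pi_RF q).
have pp' : p - p' \in skewFXn_ideal.
  by apply/asboolP/eq_skew_quotP; rewrite reprK.
have qq' : q - q' \in skewFXn_ideal.
  by apply/asboolP/eq_skew_quotP; rewrite reprK.
change (p * q - p' * q' \in skewFXn_ideal).
rewrite -[p * q](addrNK (p * q')) -mulrBr -addrA -mulrBl.
by apply: rpredD; [exact: skewFXn_idealMl | exact: skewFXn_idealMr].
Qed.
Canonical pi_skew_quot_mul_morph := PiMorph2 pi_skew_quot_mul.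

Fact skew_quot_mulA : associative skew_quot_mul.
Proof. by move=> x y z; rewrite -[x]reprK -[y]reprK -[z]reprK !piE mulrA. Qed.

Fact skew_quot_mul1l : left_id skew_quot1 skew_quot_mul.
Proof. by move=> x; rewrite -[x]reprK !piE mul1r. Qed.

Fact skew_quot_mul1r : right_id skew_quot1 skew_quot_mul.
Proof. by move=> x; rewrite -[x]reprK !piE mulr1. Qed.

Lemma pi_skew_quotD p q : \pi_RF (p + q) = \pi_RF p + \pi_RF q.
Proof. exact: (@pi_addr _ _ _ _ _ {ideal_quot skewFXn_ideal}). Qed.

Fact skew_quot_mulDl : left_distributive skew_quot_mul +%R.
Proof.
move=> x y z; rewrite -[x]reprK -[y]reprK -[z]reprK.
by rewrite -pi_skew_quotD -!pi_skew_quot_mul -pi_skew_quotD mulrDl.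
Qed.

Fact skew_quot_mulDr : right_distributive skew_quot_mul +%R.
Proof.
move=> x y z; rewrite -[x]reprK -[y]reprK -[z]reprK.
by rewrite -pi_skew_quotD -!pi_skew_quot_mul -pi_skew_quotD mulrDr.
Qed.

Lemma pi_skew_quot0 : \pi_RF 0 = 0.
Proof. exact: (@pi_zeror _ _ _ _ _ {ideal_quot skewFXn_ideal}). Qed.

Fact skew_quot1_neq0 : skew_quot1 != 0.
Proof.
rewrite -pi_skew_quot0 /skew_quot1; unlock.
apply/eq_skew_quotP => -[r]; rewrite subr0 => r1.
have r0 : r != 0 by apply: contra_eq_neq r1 => ->; rewrite mul0r oner_neq0.
have [ltF _] := Firr; have d_gt0 : (0 < d)%N by rewrite ltn_predRL.
have := coef_mul_skewFXn r0; rewrite -r1 coef1 addn_eq0 muln_eq0.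
rewrite -!leqn0 [(n <= 0)%N]leqNgt n_gt0 [(d <= 0)%N]leqNgt d_gt0 andbF /=.
move/esym/eqP; rewrite mulf_eq0 lead_coef_eq0 (negPf r0) /=.
rewrite scaler_eq0 oner_eq0 orbF lead_coef_eq0 => /eqP F0.
by rewrite F0 size_poly0 in ltF.
Qed.

HB.instance Definition _ := GRing.Zmodule_isNzRing.Build RF
  skew_quot_mulA skew_quot_mul1l skew_quot_mul1r
  skew_quot_mulDl skew_quot_mulDr skew_quot1_neq0.

Fact pi_skew_quot_zmod_morphism : zmod_morphism \pi_RF.
Proof.
move=> p q; apply: (addIr (\pi_RF q)).
by rewrite -pi_skew_quotD !subrK.
Qed.

Fact pi_skew_quot_monoid_morphism : monoid_morphism \pi_RF.
Proof. by split; [rewrite piE|move=> p q; rewrite pi_skew_quot_mul]. Qed.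

HB.instance Definition _ :=
  GRing.isZmodMorphism.Build R RF \pi_RF pi_skew_quot_zmod_morphism.
HB.instance Definition _ :=
  GRing.isMonoidMorphism.Build R RF \pi_RF pi_skew_quot_monoid_morphism.

Lemma skew_quot_small p :
  exists2 q : R, (size (q : {poly L}) <= n * d)%N & p == q %[mod RF].
Proof.
have [m] := ubnP (size (p : {poly L})); elim: m p => // m IHm p le_p.
have [le_pnd|lt_ndp] := leqP (size (p : {poly L})) (n * d); first by exists p.
set dp := (size (p : {poly L})).-1.
have p0 : (p : {poly L}) != 0 by rewrite -size_poly_gt0; apply: leq_trans lt_ndp.
have le_nd : (n * d <= dp)%N by rewrite -ltnS /dp prednK ?size_poly_gt0.
have F0 : F != 0 by have [ltF _] := Firr; rewrite -size_poly_gt0 ltnW.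
pose c := lead_coef (p : {poly L}) / (lead_coef F)%:A.
pose t : R := c%:S * skewX _ ^+ (dp - n * d).
have lF0 : (lead_coef F)%:A != 0 :> L.
  by rewrite scaler_eq0 oner_eq0 orbF lead_coef_eq0.
have c0 : c != 0 by rewrite mulf_neq0 ?invr_neq0 // lead_coef_eq0.
have tE : t = c *: 'X^(dp - n * d) :> {poly L}.
  by apply/polyP => i; rewrite coef_skew_mono coefZ coefXn mulr_natr.
have st : size (t : {poly L}) = (dp - n * d).+1.
  by rewrite tE size_scale // size_polyXn.
have t0 : t != 0 by rewrite -size_poly_eq0 st.
have ltc : lead_coef (t : {poly L}) = c.
  by rewrite tE lead_coefZ lead_coefXn mulr1.
have [|q sq /eqP pq] := IHm (p - t * skewFXn).
  apply: leq_trans (_ : dp < m)%N; last first.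
    by rewrite /dp prednK ?size_poly_gt0.
  rewrite ltnS; apply/leq_sizeP => j; rewrite leq_eqVlt coefB => /predU1P[<-|ltj].
    have := coef_mul_skewFXn t0; rewrite st /= subnK // ltc => ->.
    by rewrite /c divfK // subrr.
  rewrite nth_default ?sub0r; last by rewrite -[size _]prednK ?size_poly_gt0.
  rewrite coef_skewM big1 ?oppr0 // => i _.
  rewrite coef_skew_mono; case: eqP => [->|_]; last by rewrite mulr0n mul0r.
  rewrite skewFXn_coef_gt ?iter_sigma0 ?mulr0 //.
  by rewrite ltn_subRL subnK.
exists q => //; rewrite -pq eq_sym; apply/eq_skew_quotP; exists (- t).
by rewrite mulNr addrC addKr.
Qed.

Local Notation coefs := {ffun 'I_(n * d) -> finvect_type L}.

Lemma skew_quot_coefs (x : RF) : exists e : coefs,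
  \pi_RF (\poly_(i < n * d) (if insub i is Some j then e j else 0) : {poly L})
    == x.
Proof.
have [q sq /eqP xq] := skew_quot_small (generic_quotient.repr x).
exists [ffun i : 'I__ => (q : {poly L})`_i]; apply/eqP.
rewrite -[RHS]reprK xq; congr (\pi_RF _); apply/polyP => i.
rewrite coef_poly; case: ifP => [lti|/negbT]; last first.
  by rewrite -leqNgt => lei; rewrite nth_default // (leq_trans sq).
by rewrite insubT ffunE.
Qed.

Fact skew_quot_coefsK :
  cancel (fun x => xchoose (skew_quot_coefs x))
    (fun e : coefs => \pi_RF
      (\poly_(i < n * d) (if insub i is Some j then e j else 0) : {poly L})).
Proof. by move=> x; apply/eqP; exact: (xchooseP (skew_quot_coefs x)). Qed.

HB.instance Definition _ := CanIsCountable skew_quot_coefsK.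
HB.instance Definition _ :=
  isFinite.Build RF (pcan_enumP (can_pcan skew_quot_coefsK)).
HB.instance Definition _ := FinRing.isNzRing.Build RF.

(* Here d = deg F.  The power skewX ^+ i is taken in the ring {skew sigma}. *)
Definition skew_code (k : nat) : {set RF} :=
  [set c | `[< exists a : 'I_(d * k) -> L,
     c = \pi_RF (\sum_(i < d * k) (a i)%:S * skewX _ ^+ i) >]].

(* The pairs (g, h) of units of the quotient with g S_k(F) h = S_k(F). *)
Definition skew_code_aut (k : nat) : {set {unit RF} * {unit RF}} :=
  [set gh | [set val gh.1 * c * val gh.2 | c in skew_code k] == skew_code k].

End SkewQuotient.

(* Main.v *)
From HB Require Import structures.
Require Import Defs.
From mathcomp Require Import all_boot all_order all_fingroup all_algebra.
From mathcomp Require Import all_solvable all_field.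
From mathcomp Require Import boolp zify ring.

(* Write S for the code, the classes of degree < sk.  A degree argument shows
   that the left and right idealisers of S are L.  If g S h = S, conjugation by
   g and by h therefore preserves L, so g and h are homogeneous for the
   Z/n-grading of R_F by the degree in X.  Put w = h^-1 X h, which is
   homogeneous of degree 1.  The image V = g S' h of the classes of degree
   < sk - 1 is a hyperplane of S with V w inside S; likewise V' w^-1 is inside
   S for V' = g X S' h.
   - If 1 lies in V, leading terms force w = c X with c in L.
   - If 1 lies in V', they force w^-1 = c X, hence n = 2 and X^4 in L, which is
     the excluded case F = Y^2 - nu.
   - Otherwise sk = 1 mod n and g X^i h is homogeneous of degree i, which again
     gives w = c X.
   Now w = c X means h = b z(X^n) X^i with b in L and z over F_q.  Such an h
   satisfies S h = h S, so g h lies in the idealiser L.  Thus the group is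
   {(c h^-1, h)}, and each h comes from q - 1 triples (b, z, i). *)

Set Implicit Arguments.
Unset Strict Implicit.
Unset Printing Implicit Defensive.

Import GRing.Theory.
Local Open Scope ring_scope.

(** * Rings of skew polynomials of bounded degree *)

Section SkewCoordinates.
Variables (L : fieldType) (sigma : {rmorphism L -> L}).
Variables (A : unitRingType) (iota : {rmorphism L -> A}) (x : A) (n s : nat).
Hypothesis n_gt1 : (1 < n)%N.
Hypothesis xU : x \is a GRing.unit.
Hypothesis xC : forall a, x * iota a = iota (sigma a) * x.
Hypothesis sigma_iter : forall i j,
  (forall a, iter i sigma a = iter j sigma a) <-> i = j %[mod n].

(** Coefficients stand to the left of the powers of [x]. [ev] is additive but not multiplicative,
    since [A] is twisted and [{poly L}] is not; left scalars and right powers of ['X] do pass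
    through it. *)
Definition ev (p : {poly L}) : A := (map_poly iota p).[x].

Hypothesis ev_eq0 : forall p : {poly L}, (size p <= n * s)%N -> ev p = 0 ->
  p = 0.
Hypothesis ev_onto : forall r, exists2 p : {poly L}, (size p <= n * s)%N &
  r = ev p.

Implicit Types (p q : {poly L}) (r g h w : A) (a b c : L) (i j m : nat).

Let n_gt0 : (0 < n)%N. Proof. exact: ltnW. Qed.

Lemma ev0 : ev 0 = 0. Proof. by rewrite /ev rmorph0 horner0. Qed.
Lemma evD p q : ev (p + q) = ev p + ev q.
Proof. by rewrite /ev rmorphD hornerD. Qed.
Lemma evB p q : ev (p - q) = ev p - ev q.
Proof. by rewrite /ev rmorphB hornerD hornerN. Qed.
Lemma evC a : ev a%:P = iota a.
Proof. by rewrite /ev map_polyC hornerC. Qed.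
Lemma evZ a p : ev (a *: p) = iota a * ev p.
Proof. by rewrite /ev map_polyZ hornerZ. Qed.
Lemma evMXn p i : ev (p * 'X^i) = ev p * x ^+ i.
Proof.
elim: i => [|i IHi]; first by rewrite !mulr1.
by rewrite !exprSr !mulrA -IHi {1}/ev rmorphM /= map_polyX hornerMX.
Qed.
Lemma evXn i : ev 'X^i = x ^+ i.
Proof. by rewrite -[X in ev X]mul1r evMXn -polyC1 evC rmorph1 mul1r. Qed.
Lemma evZXn a i : ev (a *: 'X^i) = iota a * x ^+ i.
Proof. by rewrite evZ evXn. Qed.
Lemma evE m p : (size p <= m)%N ->
  ev p = \sum_(i < m) iota p`_i * x ^+ i.
Proof.
move=> sp; rewrite /ev (horner_coef_wide _ (n := m)) ?size_map_poly //.
by apply: eq_bigr => i _; rewrite coef_map.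
Qed.

Lemma xnC i a : x ^+ i * iota a = iota (iter i sigma a) * x ^+ i.
Proof.
elim: i a => [|i IHi] a; first by rewrite mul1r mulr1.
by rewrite exprSr -mulrA xC mulrA IHi -iterSr -mulrA -exprSr.
Qed.

Lemma ev_inj p q :
  (size p <= n * s)%N -> (size q <= n * s)%N -> ev p = ev q -> p = q.
Proof.
move=> sp sq e; apply/subr0_eq/ev_eq0; last by rewrite evB e subrr.
by rewrite (leq_trans (size_polyD _ _)) // geq_max size_polyN sp.
Qed.

Lemma iter_sigma_n i a : iter (n * i) sigma a = a.
Proof. by have [_ ->] := sigma_iter (n * i) 0; rewrite ?mod0n ?modnMr. Qed.

Lemma iter_sigma_onto i a : exists b, iter i sigma b = a.
Proof.
exists (iter (n * i - i) sigma a); rewrite -iterD subnKC ?iter_sigma_n //.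
by rewrite leq_pmull.
Qed.

Definition twist i p := iter i (map_poly sigma) p.

Lemma coef_twist i p j : (twist i p)`_j = iter i sigma p`_j.
Proof. by elim: i => //= i IHi; rewrite coef_map IHi. Qed.
Lemma size_twist i p : size (twist i p) = size p.
Proof. by elim: i => //= i IHi; rewrite size_map_poly. Qed.

Lemma xn_ev i p : x ^+ i * ev p = ev (twist i p * 'X^i).
Proof.
rewrite evMXn (evE (leqnn _)) (evE (_ : size (twist i p) <= size p)%N).
  rewrite big_distrr big_distrl /=; apply: eq_bigr => j _.
  by rewrite coef_twist mulrA xnC -!mulrA -!exprD addnC.
by rewrite size_twist.
Qed.

Lemma ev_iota p a :
  ev p * iota a = ev (\poly_(i < size p) (p`_i * iter i sigma a)).
Proof.
rewrite (evE (leqnn _)) (evE (size_poly _ _)) big_distrl /=.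
by apply: eq_bigr => i _; rewrite coef_poly ltn_ord rmorphM /= -!mulrA xnC.
Qed.

Lemma iota_inj : (0 < s)%N -> injective iota.
Proof.
move=> s0 a b; rewrite -!evC => /ev_inj e; apply/polyC_inj/e;
  by rewrite (leq_trans (size_polyC_leq1 _)) // muln_gt0 n_gt0.
Qed.

(* Homogeneity for the Z/n-grading of A by the degree in x. *)
Definition homog i r := forall a, r * iota a = iota (iter i sigma a) * r.

Lemma homogM i j r w : homog i r -> homog j w -> homog (i + j) (r * w).
Proof. by move=> hr hw a; rewrite -mulrA hw mulrA hr -iterD mulrA. Qed.

Lemma homog_xn i : homog i (x ^+ i).
Proof. by move=> a; rewrite xnC. Qed.

Lemma homog_mod i j r : i = j %[mod n] -> homog i r -> homog j r.
Proof. by move=> /sigma_iter e hr a; rewrite hr e. Qed.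

(** The exponent [n * i - i] is a natural number standing for -i modulo n. *)
Lemma homogV i r : r \is a GRing.unit -> homog i r ->
  homog (n * i - i) r^-1.
Proof.
move=> rU hr a; apply: (mulrI rU); rewrite mulrA divrr // mul1r mulrA hr.
by rewrite -iterD subnKC ?leq_pmull // iter_sigma_n -mulrA divrr ?mulr1.
Qed.

(** Comparing coefficients at j gives p_j sigma^j(a) = sigma^i(a) p_j for every a, so p_j can be
    nonzero only where sigma^j = sigma^i. *)
Lemma homog_coef i p j : (size p <= n * s)%N -> homog i (ev p) ->
  p`_j != 0 -> j = i %[mod n].
Proof.
move=> sp hp pj; apply/sigma_iter => a.
have := hp a; rewrite ev_iota -evZ => /ev_inj e.
have {e} /(congr1 (coefp j)) : \poly_(i < size p) (p`_i * iter i sigma a)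
    = iter i sigma a *: p.
  by apply: e; rewrite ?(leq_trans (size_poly _ _))
    ?(leq_trans (size_scale_leq _ _)).
rewrite /= coefZ coef_poly.
case: ltnP => [_|lej]; last by rewrite nth_default ?eqxx in pj.
by rewrite mulrC => /(mulIf pj).
Qed.

(** For m = sk this is the code S. *)
Definition low m r := exists2 p : {poly L}, (size p <= m)%N & r = ev p.

Lemma low_mono m i a : (i < m)%N -> low m (iota a * x ^+ i).
Proof.
move=> im; exists (a *: 'X^i); last by rewrite evZXn.
by rewrite (leq_trans (size_scale_leq _ _)) // size_polyXn.
Qed.

Lemma low_xn m i : (i < m)%N -> low m (x ^+ i).
Proof. by move=> im; rewrite -[x ^+ i]mul1r -(rmorph1 iota);
  apply: low_mono. Qed.

Lemma lowD m r w : low m r -> low m w -> low m (r + w).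
Proof.
move=> [p sp ->] [q sq ->]; exists (p + q); last by rewrite evD.
by rewrite (leq_trans (size_polyD _ _)) // geq_max sp.
Qed.

Lemma low_iota m a r : low m r -> low m (iota a * r).
Proof.
move=> [p sp ->]; exists (a *: p); last by rewrite evZ.
by rewrite (leq_trans (size_scale_leq _ _)).
Qed.

Lemma lowP m r p : (m <= n * s)%N -> (size p <= n * s)%N ->
  low m r -> r = ev p -> (size p <= m)%N.
Proof.
move=> mN sp [q sq ->] e; rewrite -(ev_inj _ sp e) //.
exact: leq_trans mN.
Qed.

(** The only exponent below i + n that is congruent to i modulo n is i itself. *)
Lemma low_homog m r i : (m <= n * s)%N -> homog i r -> low m r ->
  (i < n)%N -> (m <= i + n)%N -> exists a, r = iota a * x ^+ i.
Proof.
move=> mN hr [p sp rE] i_n m_in; exists p`_i.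
rewrite rE -evZXn; congr (ev _); apply/polyP => j.
rewrite coefZ coefXn; case: eqP => [->|ji]; first by rewrite mulr1.
rewrite mulr0; apply/eqP; apply: contraT => pj; case: ji.
have jm : (j < m)%N.
  by rewrite ltnNge; apply: contra pj => mj;
    rewrite nth_default // (leq_trans sp).
rewrite rE in hr.
have /homog_coef/(_ pj)/eqP := hr; rewrite (leq_trans sp) // => /(_ isT).
rewrite [(i %% n)%N]modn_small // => /eqP e.
have := divn_eq j n; rewrite e; case: (j %/ n)%N => [|k]; lia.
Qed.

(* An element stabilising low m on one side is a scalar: multiplying it by a
   suitable power of x moves its leading term to degree m. *)
Lemma low_stab1 m r (sm : (0 < m < n * s)%N) :
  low m r -> (forall i, (i < m)%N -> low m (r * x ^+ i) \/ low m (x ^+ i * r))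
    ->
  exists a, r = iota a.
Proof.
move=> [p sp ->] H; case/andP: sm => m0 mN.
suff /size1_polyC -> : (size p <= 1)%N by exists p`_0; rewrite evC.
rewrite leqNgt; apply/negP => p1; have p0 : p != 0.
  by rewrite -size_poly_gt0 ltnW.
have [||] := H (m - (size p).-1)%N; first by lia.
  rewrite -evMXn => /lowP/(_ erefl); rewrite size_mulXn //.
  by move=> H'; have := H' (ltnW mN); lia.
rewrite xn_ev => /lowP/(_ erefl).
rewrite size_mulXn -?size_poly_eq0 size_twist ?size_poly_eq0 //.
by move=> H'; have := H' (ltnW mN); lia.
Qed.

Lemma low_iotar m a r : low m r -> low m (r * iota a).
Proof.
move=> [p sp ->]; rewrite ev_iota; eexists; last by [].
exact: leq_trans (size_poly _ _) sp.
Qed.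

Lemma xn_central r : x ^+ n * r = r * x ^+ n.
Proof.
have [p _ ->] := ev_onto r; rewrite xn_ev -evMXn; congr (ev (_ * _)).
by apply/polyP => j; rewrite coef_twist -[n]muln1 iter_sigma_n.
Qed.

Lemma xnM_central i r : x ^+ (n * i) * r = r * x ^+ (n * i).
Proof. by rewrite exprM; apply/commr_sym/commrX/commr_sym/xn_central. Qed.

(** If sigma^j(b) h = h c with j the degree of h, the leading coefficients give sigma^j(b) =
    sigma^j(c), so c = b. *)
Lemma norm_homogr h : h != 0 -> (forall a, exists b, iota a * h = h * iota b) ->
  exists i, homog i h.
Proof.
have [p sp ->] := ev_onto h => h0 H.
have p0 : p != 0 by apply: contraNneq h0 => ->; rewrite ev0.
exists (size p).-1 => b; set j := (size p).-1.
have [c e] := H (iter j sigma b); rewrite e; congr (_ * iota _).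
have := e; rewrite ev_iota -evZ => /ev_inj.
rewrite (leq_trans (size_poly _ _)) // (leq_trans (size_scale_leq _ _)) //.
move=> /(_ isT isT)/(congr1 (coefp j)) /=.
rewrite coefZ coef_poly /j prednK ?size_poly_gt0 // leqnn mulrC => /mulfI e'.
suff: iter j sigma (b - c) = 0 by move/eqP;
  rewrite iter_sigma_eq0 subr_eq0 => /eqP.
rewrite iter_sigmaD -[- c]mulN1r iter_sigmaM e'; last first.
  by rewrite -/(lead_coef p) lead_coef_eq0.
by rewrite -iter_sigmaM -iter_sigmaD mulN1r subrr iter_sigma0.
Qed.

Lemma norm_homogl g : g != 0 -> (forall a, exists b, g * iota a = iota b * g) ->
  exists i, homog i g.
Proof.
have [p sp ->] := ev_onto g => g0 H.
have p0 : p != 0 by apply: contraNneq g0 => ->; rewrite ev0.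
exists (size p).-1 => b; have [c e] := H b; rewrite e; congr (iota _ * _).
have := e; rewrite ev_iota -evZ => /ev_inj.
rewrite (leq_trans (size_poly _ _)) // (leq_trans (size_scale_leq _ _)) //.
move=> /(_ isT isT)/(congr1 (coefp (size p).-1)) /=.
rewrite coefZ coef_poly prednK ?size_poly_gt0 // leqnn mulrC => /mulIf <- //.
by rewrite -/(lead_coef p) lead_coef_eq0.
Qed.

(** * Automorphisms of the code are monomial up to central scalars *)

Section Automorphism.
Variables (m : nat) (g h : A).
Hypotheses (m_gt1 : (1 < m)%N) (m_lt : (m + 1 < n * s)%N).
Hypotheses (gU : g \is a GRing.unit) (hU : h \is a GRing.unit).
Hypothesis gh_low : forall r, low m r -> low m (g * r * h).
Hypothesis ghV_low : forall r, low m r -> low m (g^-1 * r * h^-1).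

Let mN : (m <= n * s)%N. Proof. by lia. Qed.

(** h^-1 L h lies in the right idealiser of [low m]: apply r -> g^-1 r h^-1, multiply by a scalar on
    the right, and map back. By [low_stab1] such elements are scalars, so h normalises L. *)
Lemma aut_homogr : exists i, homog i h.
Proof.
apply: norm_homogr => [|a]; first by apply: contraTneq hU => ->; rewrite unitr0.
have stab r : low m r -> low m (r * (h^-1 * iota a * h)).
  move=> /ghV_low/(low_iotar a)/gh_low.
  by rewrite !mulrA divrr // mul1r.
have [|||b e] := @low_stab1 m (h^-1 * iota a * h).
- by lia.
- by rewrite -[X in low _ X]mul1r -(expr0 x); apply/stab/low_xn; lia.
- by move=> i im; right; apply/stab/low_xn.
by exists b; rewrite -e !mulrA divrr // mul1r.
Qed.

Lemma aut_homogl : exists i, homog i g.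
Proof.
apply: norm_homogl => [|a]; first by apply: contraTneq gU => ->; rewrite unitr0.
have stab r : low m r -> low m (g * iota a * g^-1 * r).
  move=> /ghV_low/(low_iota a)/gh_low.
  by rewrite !mulrA mulrVK.
have [|||b e] := @low_stab1 m (g * iota a * g^-1).
- by lia.
- by rewrite -[X in low _ X]mulr1 -(expr0 x); apply/stab/low_xn; lia.
- by move=> i im; left; apply/stab/low_xn.
by exists b; rewrite -e mulrVK.
Qed.

Let w := h^-1 * x * h.

Let wU : w \is a GRing.unit.
Proof. by rewrite /w !unitrMl ?unitrV. Qed.

Lemma aut_conj_homog : homog 1 w.
Proof.
have [j hj] := aut_homogr.
apply: homog_mod (homogM (homogM (homogV hU hj) (homog_xn 1)) hj).
by rewrite -addnA [(1 + j)%N]addnC addnA subnK ?leq_pmull // addnC -modnDmr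
  modnMr addn0.
Qed.

(* The condition p`_k = 0 cuts out a hyperplane of low m, so its image under
   r |-> g r h meets every plane spanned by two powers of x nontrivially. *)
Lemma aut_pencil k i : (i.+1 < m)%N -> exists a b p,
  [/\ (a != 0) || (b != 0), (size p <= m)%N, p`_k = 0 &
      iota a * x ^+ i + iota b * x ^+ i.+1 = g * ev p * h].
Proof.
move=> im; have [j hj] := aut_homogl; have hV := homogV gU hj.
set j' := (n * j - j)%N in hV.
have [p sp pE] := ghV_low (low_xn (ltnW im)).
have [q sq qE] := ghV_low (low_xn im).
have [al [be [ab e]]] : exists al be : L,
    ((al != 0) || (be != 0)) /\ al * p`_k + be * q`_k = 0.
  have [q0|q0] := eqVneq q`_k 0.
    by exists 0, 1; rewrite oner_neq0 orbT q0 mul0r mulr0 addr0.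
  by exists q`_k, (- p`_k); rewrite q0 mulNr mulrC subrr.
(* g^-1 is homogeneous of degree [j'], so a scalar a becomes sigma^j'(a) on the preimage; [al] and
   [be] are untwisted accordingly. *)
have [a aE] := iter_sigma_onto j' al; have [b bE] := iter_sigma_onto j' be.
exists a, b, (al *: p + be *: q); split.
- by rewrite -(iter_sigma_eq0 sigma j' a) -(iter_sigma_eq0 sigma j' b) aE bE.
- rewrite (leq_trans (size_polyD _ _)) // geq_max.
  by rewrite !(leq_trans (size_scale_leq _ _)).
- by rewrite coefD !coefZ.
rewrite evD !evZ -pE -qE -aE -bE !mulrA -!hV mulrDr mulrDl !mulrA.
by rewrite !divrr // !mul1r !mulrVK.
Qed.

(** Suppose w' has degree D > 1 and take i = m - D. In the product, the coefficient at m + 1 is b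
    times a nonzero factor; once b = 0, the one at m is a times a nonzero factor. As m + 1 < ns
    nothing is reduced, so both vanish and a = b = 0. *)
Lemma low_pencil w' : low m w' -> w' != 0 ->
  (forall i, (i.+1 < m)%N -> exists a b, ((a != 0) || (b != 0)) /\
     low m ((iota a * x ^+ i + iota b * x ^+ i.+1) * w')) ->
  low 2 w'.
Proof.
move=> [p sp ->] w0 H; exists p => //; rewrite leqNgt; apply/negP => p2.
have lp : p`_(size p).-1 != 0.
  by rewrite -/(lead_coef p) lead_coef_eq0 -size_poly_gt0; lia.
set D := (size p).-1 in lp; have DE : size p = D.+1 by rewrite /D prednK //;
  lia.
have Dm : (D < m)%N by rewrite -DE.
have [|a [b [ab lo]]] := H (m - D)%N; first by lia.
set i := (m - D)%N in lo; have iE : i = (m - D)%N by [].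
pose q := a *: (twist i p * 'X^i) + b *: (twist i.+1 p * 'X^(i.+1)).
have sq : (size q <= m.+2)%N.
  rewrite (leq_trans (size_polyD _ _)) // geq_max.
  rewrite !(leq_trans (size_scale_leq _ _)) //.
  - apply/leq_sizeP => j mj; rewrite coefMXn; case: ifP => // _.
    by rewrite coef_twist nth_default ?iter_sigma0 // DE; lia.
  - apply/leq_sizeP => j mj; rewrite coefMXn; case: ifP => // _.
    by rewrite coef_twist nth_default ?iter_sigma0 // DE; lia.
have {}lo : (size q <= m)%N.
  apply: (lowP mN _ lo); first by lia.
  by rewrite /q evD !evZ mulrDl -!mulrA !xn_ev.
have qk j : (m <= j)%N -> q`_j = 0 by move=> mj;
  rewrite nth_default // (leq_trans lo).
have := qk m.+1; rewrite coefD !coefZ !coefMXn !coef_twist.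
have -> : (m.+1 - i.+1)%N = D by lia.
rewrite [p`_(m.+1 - i)]nth_default ?iter_sigma0; last by rewrite DE; lia.
rewrite if_same mulr0 add0r ifF; last by lia.
move=> /(_ (leqnSn _))/eqP; rewrite mulf_eq0 iter_sigma_eq0 (negPf lp) orbF =>
  /eqP b0.
have := qk m; rewrite coefD !coefZ !coefMXn !coef_twist b0 mul0r addr0.
have -> : (m - i)%N = D by lia.
rewrite ifF; last by lia.
move=> /(_ (leqnn _))/eqP; rewrite mulf_eq0 iter_sigma_eq0 (negPf lp) orbF =>
  /eqP a0.
by rewrite a0 b0 eqxx in ab.
Qed.

(** Since h w = x h, right multiplication by [w] replaces p by p x, which stays in [low m] when the
    top coefficient is zero. *)
Lemma aut_low_top p : (size p <= m)%N -> p`_(m - 1) = 0 ->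
  low m (g * ev p * h * w).
Proof.
move=> sp pm; rewrite /w !mulrA mulrK //.
have -> : g * ev p * x * h = g * ev (p * 'X) * h.
  by rewrite -['X]expr1 evMXn expr1 mulrA.
apply: gh_low; exists (p * 'X) => //; apply/leq_sizeP => j mj.
rewrite coefMX; case: eqP => // j0.
have [<-//|ne] := eqVneq (m - 1)%N j.-1.
by rewrite nth_default // (leq_trans sp) //; lia.
Qed.

(** Dually, a zero constant term makes p divisible by x on the right, and [w^-1] removes that
    factor. *)
Lemma aut_low_bot p : (size p <= m)%N -> p`_0 = 0 ->
  low m (g * ev p * h * w^-1).
Proof.
move=> sp p0; have -> : p = (\poly_(i < m) p`_i.+1) * 'X.
  apply/polyP => -[|j]; rewrite coefMX //= coef_poly; case: ltnP => // mj.
  by rewrite nth_default // (leq_trans sp) // leqW.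
set q := \poly_(_ < m) _; rewrite -['X]expr1 evMXn expr1.
have -> : g * (ev q * x) * h * w^-1 = g * ev q * h; last first.
  by apply: gh_low; exists q; rewrite ?size_poly.
by apply: (mulIr wU); rewrite mulrVK // /w !mulrA mulrK.
Qed.

(** With 1 in the image of the hyperplane p_k = 0, w' itself lies in [low m], and [aut_pencil]
    supplies what [low_pencil] needs. *)
Lemma aut_low_small w' k : w' != 0 ->
  (forall p, (size p <= m)%N -> p`_k = 0 -> low m (g * ev p * h * w')) ->
  forall p, (size p <= m)%N -> p`_k = 0 -> g * ev p * h = 1 -> low 2 w'.
Proof.
move=> w0 H p sp pk p1; apply: low_pencil => //.
  by rewrite -[w']mul1r -p1; apply: H.
move=> i im; have [a [b [q [ab sq qk e]]]] := aut_pencil k im.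
by exists a, b; split=> //; rewrite e; apply: H.
Qed.

(* Were g x^i h not a monomial, multiplying it by the largest power of the
   central element x^n that keeps x^i inside low m would move it outside. *)
Lemma aut_mono i k : homog i (g * x ^+ i * h) -> (i < n)%N -> (i < m)%N ->
    (m <= i + n * k < n * s)%N -> (i + n * k < m + n)%N ->
  exists2 c, c != 0 & g * x ^+ i * h = iota c * x ^+ i.
Proof.
move=> hi i_n i_m /andP[m_a a_N] a_m.
have nz : g * x ^+ i * h != 0.
  by apply: contraTneq isT => /(congr1 (fun r => r \is a GRing.unit));
     rewrite !unitrMl ?unitrX // gU unitr0.
suff lo : low (i + n) (g * x ^+ i * h).
  have [|||c e] := low_homog _ hi lo => //.
    by rewrite (leq_trans _ (ltnW a_N)) // leq_add2l leq_pmulr //;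
      case: k m_a a_N a_m; lia.
  by exists c => //; apply: contra_neq nz => c0; rewrite e c0 rmorph0 mul0r.
have [p sp pE] := gh_low (low_xn i_m); exists p => //.
rewrite pE in hi nz; rewrite leqNgt; apply/negP => lt_p.
have DE : size p = (size p).-1.+1 by rewrite prednK //; lia.
have lp : p`_(size p).-1 != 0.
  by rewrite -/(lead_coef p) lead_coef_eq0 -size_poly_gt0; lia.
have /eqP := homog_coef (leq_trans sp mN) hi lp.
set D := (size p).-1 in DE lp * => /eqP e.
have DtE := divn_eq D n; set t := (D %/ n)%N in DtE.
rewrite e [(i %% n)%N]modn_small // [(t * n)%N]mulnC in DtE.
have t0 : (0 < t)%N by case: (t) DtE; lia.
have ta : (t < k)%N by rewrite -(ltn_pmul2l n_gt0); lia.
(* The leading exponent of p is i + nt with t > 0. Multiplying by x^(n(k-t)) sends it to i + nk >=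
   m, although x^(i+n(k-t)) still lies in [low m]. *)
have := low_xn (_ : i + n * (k - t) < m)%N; rewrite mulnBr.
have nt : (n <= n * t)%N by rewrite leq_pmulr.
have nta : (n * t <= n * k)%N by rewrite leq_mul2l ltnW ?orbT.
rewrite -mulnBr => /(_ (ltac:(lia)))/gh_low.
have -> : g * x ^+ (i + n * (k - t)) * h = ev (p * 'X^(n * (k - t))).
  by rewrite evMXn -pE exprD mulrA -mulrA xnM_central mulrA.
move/(lowP mN)/(_ erefl); rewrite size_mulXn -?size_poly_eq0 DE //.
by rewrite mulnBr; lia.
Qed.

(** The case is read off the preimage p of 1: a zero coefficient at m - 1 puts 1 in V, a zero
    constant term puts 1 in V', and otherwise the two nonzero end coefficients restrict the degrees
    modulo n. *)
Lemma aut_conj_cases : (exists c, w = iota c * x) \/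
  n = 2%N /\ exists c, x ^+ 4 = iota c.
Proof.
have w0 : w != 0 by apply: contraTneq wU => ->; rewrite unitr0.
have wV0 : w^-1 != 0 by apply: contraTneq wU; rewrite -unitrV => ->;
  rewrite unitr0.
have hw := aut_conj_homog; have hwV := homogV wU hw.
have [|p sp pE] := ghV_low (low_xn (_ : 0 < m)%N); first by lia.
have p1 : g * ev p * h = 1.
  by rewrite -pE expr0 mulr1 mulrA divrr // mul1r mulVr.
have [pm|pm] := eqVneq p`_(m - 1) 0.
  have /low_homog := aut_low_small w0 aut_low_top sp pm p1.
  move=> /(_ _ _ hw) []; rewrite ?leq_addr //; first by lia.
  by move=> c ->; left; exists c.
have [p0|p0] := eqVneq p`_0 0.
  have lo := aut_low_small wV0 aut_low_bot sp p0 p1; right.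
  (* [w^-1] has degree at most 1 and is homogeneous of degree n - 1, so n - 1 is congruent to 0 or 1
     modulo n. *)
  have n2 : n = 2%N.
    have [q sq qE] := lo; rewrite qE in hwV wV0.
    have lq : q`_(size q).-1 != 0.
      rewrite -/(lead_coef q) lead_coef_eq0.
      by apply: contraNneq wV0 => ->; rewrite ev0.
    have := homog_coef (_ : (size q <= n * s)%N) hwV lq.
    have sN := leq_trans (leq_trans sq m_gt1) mN; move=> /(_ sN).
    move: n_gt1 sq; move: (size q) => l; clear; rewrite muln1.
    case: l => [|[|[|//]]] /= n1 _; rewrite !modn_small; lia.
  split=> //; have [|||c e] := low_homog _ hwV lo; [by lia..|].
  rewrite n2 muln1 expr1 in e.
  (* x^2 is central, so conjugation by h fixes it. With w^-1 = c x this gives c sigma(c) x^4 = w^-2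
     w^2 = 1. *)
  have e2 : w ^+ 2 = x ^+ 2.
    by rewrite expr2 /w !mulrA mulrK // -(mulrA h^-1) -expr2 -n2 -mulrA
      xn_central mulKr.
  have e4 : iota (c * sigma c) * x ^+ 4 = 1.
    have wE : iota (c * sigma c) * x ^+ 2 = w^-1 * w^-1.
      by rewrite e rmorphM expr2 !mulrA -[iota c * x * iota c]mulrA xC !mulrA.
    by rewrite (exprD x 2 2) mulrA wE -e2 expr2 -mulrA mulKr // mulVr.
  have nz : c * sigma c != 0.
    apply: contra_eq_neq e4 => ->.
    by rewrite rmorph0 mul0r eq_sym oner_neq0.
  exists (c * sigma c)^-1; have U : iota (c * sigma c) \is a GRing.unit.
    by rewrite rmorph_unit // unitfE.
  by apply: (mulrI U); rewrite e4 -rmorphM divff // rmorph1.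
left.
have [i hi] := aut_homogl; have [j hj] := aut_homogr.
have hg := homogM (homogV gU hi) (homogV hU hj).
(* p represents g^-1 h^-1, homogeneous of degree -(i + j); as its coefficients at 0 and m - 1 are
   nonzero, both exponents are congruent to that degree. *)
have ij : i + j = 0 %[mod n] /\ m - 1 = 0 %[mod n].
  rewrite expr0 mulr1 in pE; rewrite pE in hg.
  have e1 := homog_coef (leq_trans sp mN) hg pm.
  have e0 := homog_coef (leq_trans sp mN) hg p0.
  split; last by rewrite e1 e0.
  have dv : (n %| (n * i - i) + (n * j - j))%N by apply/eqP; rewrite -e0 mod0n.
  apply/eqP; rewrite mod0n -/(n %| _)%N -(dvdn_addl _ dv) addnACA.
  by rewrite !subnKC ?leq_pmull // -mulnDr dvdn_mulr.
case: ij => ij /eqP; rewrite mod0n => /dvdnP[a aE].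
have hgh k : homog k (g * x ^+ k * h).
  apply: homog_mod (homogM (homogM hi (homog_xn k)) hj).
  by rewrite addnAC -modnDml ij modnDml.
(* (g x^k h) w = g x^(k+1) h, so two consecutive monomial images determine w. *)
have step k c d : c != 0 -> g * x ^+ k * h = iota c * x ^+ k ->
    g * x ^+ k.+1 * h = iota d * x ^+ k.+1 -> exists c, w = iota c * x.
  move=> c0 ec ed; have [b bE] := iter_sigma_onto k (d / c); exists b.
  have cU : iota c \is a GRing.unit by rewrite rmorph_unit ?unitfE.
  apply: (mulrI (unitrX k xU)); apply: (mulrI cU).
  have -> : iota c * (x ^+ k * (iota b * x)) = iota d * x ^+ k.+1.
    rewrite [x ^+ k * _]mulrA xnC bE -mulrA -exprSr mulrA -rmorphM.
    by rewrite [c * _]mulrC divfK.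
  by rewrite -ed mulrA -ec /w !mulrA mulrK // exprSr !mulrA.
have mE : m = (n * a).+1 by rewrite mulnC -aE subn1 prednK // ltnW.
have na : (n <= n * a)%N by rewrite leq_pmulr //; case: (a) mE m_gt1;
  rewrite ?muln0 => // ->.
have [||||c1 nz1 e1] := aut_mono (hgh 1%N) (k := a).
- exact: n_gt1.
- exact: m_gt1.
- by rewrite add1n -mE leqnn /= (leq_trans _ m_lt) // addn1.
- by rewrite add1n -mE -[X in (X < _)%N]addn0 ltn_add2l.
(* Now m = na + 1. At exponent 0, [aut_mono] needs na + n = m + n - 1 < ns, which m + 1 < ns grants
   for n = 2. For larger n the consecutive exponents 1 and 2 are used, both below n. *)
have [n2|n2] := eqVneq n 2%N.
  have [||||c0 nz0 e0] := aut_mono (hgh 0%N) (k := a.+1).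
  - exact: n_gt0.
  - exact: ltnW m_gt1.
  - by rewrite add0n mulnS; apply/andP; move: (n * s)%N (n * a)%N mE m_lt n2;
    clear; lia.
  - by rewrite add0n mulnS; move: (n * a)%N mE n2; clear; lia.
  exact: step nz0 e0 e1.
have n3 : (2 < n)%N by rewrite ltn_neqAle eq_sym n2.
have [||||c2 nz2 e2] := aut_mono (hgh 2%N) (k := a).
- exact: n3.
- by rewrite mE ltnS (leq_trans _ na) // ltnW.
- by apply/andP; move: (n * s)%N (n * a)%N mE m_lt; clear; lia.
- by move: (n * a)%N mE n3; clear; lia.
exact: step nz1 e1 e2.
Qed.

End Automorphism.
(** * Central multiples of monomials *)

Section BaseField.
Variables (K : fieldType) (f : {rmorphism K -> L}).
Hypothesis sigma_f : forall t, sigma (f t) = f t.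
Hypothesis sigma_fixed : forall a, sigma a = a -> exists t, a = f t.
Implicit Types (z : {poly K}) (v : 'rV[K]_s).

(** [central z] is z(x^n); for K = F_q these are the images of the center F_q[X^n] of the skew
    polynomial ring. *)
Definition central_poly z : {poly L} := map_poly f z \Po 'X^n.
Definition central z := ev (central_poly z).

Lemma coef_central_poly z i :
  (central_poly z)`_i = if (n %| i)%N then f z`_(i %/ n) else 0.
Proof. by rewrite coef_comp_poly_Xn // coef_map. Qed.

Lemma iter_sigma_f i t : iter i sigma (f t) = f t.
Proof. by elim: i => //= i ->. Qed.

Lemma centralD : {morph central : z1 z2 / z1 + z2}.
Proof. by move=> z1 z2; rewrite /central /central_poly rmorphD comp_polyD evD.
  Qed.
Lemma centralZ t z : central (t *: z) = iota (f t) * central z.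
Proof. by rewrite /central /central_poly map_polyZ comp_polyZ evZ. Qed.
Lemma centralMX z : central (z * 'X) = central z * x ^+ n.
Proof.
by rewrite /central /central_poly rmorphM /= map_polyX comp_polyM comp_polyX
  evMXn.
Qed.
Lemma central1 : central 1 = 1.
Proof. by rewrite /central /central_poly rmorph1 comp_polyC evC rmorph1. Qed.

(** Although [ev] is not multiplicative, x^n is central, and induction on z1 peels off one factor
    x^n at a time. *)
Lemma centralM : {morph central : z1 z2 / z1 * z2}.
Proof.
move=> z1 z2; elim/poly_ind: z1 => [|z1 t IHz].
  by rewrite mul0r /central /central_poly rmorph0 comp_poly0 ev0 mul0r.
rewrite mulrDl !centralD mulrDl -mulrA ['X * z2]mulrC mulrA !centralMX IHz.
rewrite mul_polyC centralZ -[t%:P]mulr1 mul_polyC centralZ central1 mulr1.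
by rewrite -!mulrA xn_central.
Qed.

Lemma central_xn z i : x ^+ i * central z = central z * x ^+ i.
Proof.
rewrite xn_ev evMXn; congr (ev _ * _); apply/polyP => j.
by rewrite coef_twist coef_central_poly; case: ifP;
  rewrite ?iter_sigma_f ?iter_sigma0.
Qed.

Lemma central_iota z a : central z * iota a = iota a * central z.
Proof.
rewrite /central ev_iota -evZ; congr (ev _); apply/polyP => i.
rewrite coef_poly coefZ; case: ltnP => [_|le];
  last by rewrite nth_default // mulr0.
rewrite coef_central_poly; case: ifP => [/dvdnP[l ->]|_];
  last by rewrite mul0r mulr0.
by rewrite [(l * n)%N]mulnC iter_sigma_n mulrC.
Qed.

(** The Bezout relation between F and z yields an inverse of z(x^n), because F(x^n) = 0. *)
Lemma central_unit (F : {poly K}) z : irreducible_poly F -> central F = 0 ->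
  z != 0 -> (size z < size F)%N -> central z \is a GRing.unit.
Proof.
move=> Firr F0 z0 zF; have cop : coprimep F z.
  rewrite irreducible_poly_coprime //; apply/negP => /(dvdp_leq z0).
  by rewrite leqNgt zF.
have [u] := Bezout_eq1_coprimepP _ _ cop => /(congr1 central).
rewrite centralD !centralM F0 mulr0 add0r central1 => uz.
by apply/unitrP; exists (central u.2); split=> //;
  rewrite -centralM mulrC centralM.
Qed.

(** The row [v] encodes the polynomial z of degree < s; over a finite K such rows form a finite type
    of known cardinality. *)
Definition smono b v i : A := iota b * central (rVpoly v) * x ^+ i.

Definition smono_poly b v i := b *: (central_poly (rVpoly v) * 'X^i).

Lemma smono_ev b v i : smono b v i = ev (smono_poly b v i).
Proof. by rewrite evZ evMXn /smono mulrA. Qed.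

Lemma coef_smono b v i j : (i < n)%N -> (smono_poly b v i)`_j =
  if (i <= j)%N && (n %| j - i)%N then b * f (rVpoly v)`_((j - i) %/ n) else 0.
Proof.
move=> i_n; rewrite coefZ coefMXn coef_central_poly ltnNge.
by case: leqP => //=; [case: ifP => //|]; rewrite mulr0.
Qed.

Lemma size_smono b v i : (i < n)%N -> (size (smono_poly b v i) <= n * s)%N.
Proof.
move=> i_n; apply/leq_sizeP => j Nj; rewrite coef_smono //;
  case: ifP => // /andP[ij].
move=> /dvdnP[l lE]; rewrite lE mulnK // nth_default ?rmorph0 ?mulr0 //.
rewrite (leq_trans (size_poly _ _)) // -ltnS -(ltn_pmul2l n_gt0) mulnS
  [(n * l)%N]mulnC -lE.
lia.
Qed.

Lemma smono_homog b v i : homog i (smono b v i).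
Proof.
move=> a; rewrite /smono -mulrA xnC !mulrA; congr (_ * _).
by rewrite -mulrA central_iota mulrA -rmorphM mulrC rmorphM.
Qed.

Lemma smono_unit (F : {poly K}) b v i : irreducible_poly F -> central F = 0 ->
  size F = s.+1 -> b != 0 -> v != 0 -> smono b v i \is a GRing.unit.
Proof.
move=> Firr F0 sF b0 v0; rewrite unitrMl ?unitrX // unitrMl.
  by rewrite rmorph_unit ?unitfE.
apply: (central_unit Firr F0); last by rewrite sF ltnS size_poly.
by apply: contra_neq v0 => /(congr1 (poly_rV (d := s)));
  rewrite rVpolyK linear0.
Qed.

(** Nonzero coefficients sit at exponents congruent to i, which determines i < n. Then b f(v_k) = b'
    f(v'_k) for all k makes v and v' proportional over K. This ambiguity is the factor q - 1 of the
    count. *)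
Lemma smono_eq b v i b' v' i' : (i < n)%N -> (i' < n)%N ->
  b != 0 -> v != 0 -> b' != 0 -> v' != 0 -> smono b v i = smono b' v' i' ->
  i = i' /\ exists2 t, t != 0 & b' = b / f t /\ v' = t *: v.
Proof.
move=> i_n i_n' b0 v0 b0' v0'; rewrite !smono_ev => /ev_inj.
move=> /(_ (size_smono _ _ i_n) (size_smono _ _ i_n')) e.
have [l vl] : exists l, v 0 l != 0.
  apply/existsP; apply: contraR v0 => /existsPn H; apply/eqP/rowP => l.
  by rewrite mxE; apply/eqP; move: (H l); rewrite negbK.
have coefi (u : 'rV[K]_s) c (k : 'I_s) : (smono_poly c u i)`_(i + n * k)%N = c
  * f (u 0 k).
  by rewrite coef_smono // leq_addr addKn dvdn_mulr //= mulKn //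
    coef_rVpoly_ord.
have ii' : i = i'.
  have := congr1 (coefp (i + n * l)%N) e; rewrite /= coefi coef_smono //.
  case: ifP => [/andP[le /dvdnP[k kE]] _|_ /eqP]; last first.
    by rewrite mulf_eq0 fmorph_eq0 (negPf b0) (negPf vl).
  have : (i + n * l = i' + k * n)%N by rewrite -kE subnKC.
  move=> /(congr1 (modn^~ n)); rewrite -modnDmr modnMr addn0 -[RHS]modnDmr
    modnMl addn0.
  by rewrite !modn_small.
split=> //; rewrite -{}ii' in e.
have ek k : b * f (v 0 k) = b' * f (v' 0 k) by rewrite -!coefi e.
have vl' : v' 0 l != 0.
  apply: contraTneq (mulf_neq0 b0 (_ : f (v 0 l) != 0)) => [vl'|].
    by rewrite ek vl' rmorph0 mulr0 eqxx.
  by rewrite fmorph_eq0.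
have fl : f (v 0 l) != 0 by rewrite fmorph_eq0.
have fl' : f (v' 0 l) != 0 by rewrite fmorph_eq0.
exists (v' 0 l / v 0 l); first by rewrite mulf_neq0 ?invr_neq0.
have bE : b' = b / f (v' 0 l / v 0 l).
  by rewrite fmorph_div invf_div mulrA ek mulfK.
split=> //; apply/rowP => k; rewrite mxE; apply: (fmorph_inj f).
apply: (mulfI b0'); rewrite -ek rmorphM /= mulrA {1}bE divfK //.
by rewrite fmorph_eq0 mulf_neq0 ?invr_neq0.
Qed.

Lemma smono_scale b v i t : t != 0 -> smono (b / f t) (t *: v) i = smono b v i.
Proof.
move=> t0; rewrite /smono linearZ /= centralZ !mulrA -rmorphM divfK //.
by rewrite fmorph_eq0.
Qed.

(** Moving a monomial of r past b z(x^n) x^i changes its scalar and keeps its exponent. *)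
Lemma low_smono m b v i r : b != 0 -> low m r ->
  exists2 r', low m r' & r * smono b v i = smono b v i * r'.
Proof.
move=> b0 [p sp ->]; rewrite (evE sp).
elim/big_ind: _ => [|r1 r2 [r1' lo1 e1] [r2' lo2 e2]|j _].
- exists 0; last by rewrite mul0r mulr0.
  by exists 0; rewrite ?ev0 ?size_poly0.
- exists (r1' + r2'); first exact: lowD.
  by rewrite mulrDl e1 e2 mulrDr.
have [c cE] := iter_sigma_onto i (p`_j * iter j sigma b / b).
exists (iota c * x ^+ j); first exact: low_mono.
rewrite mulrA smono_homog cE /smono -!mulrA !(mulrA (x ^+ j)) xnC -!mulrA.
rewrite (mulrA (x ^+ j)) central_xn !mulrA -!rmorphM divfK // -!mulrA -!exprD.
by rewrite addnC.
Qed.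

Lemma smono_xn b v i j : b != 0 ->
  smono b v i * x ^+ j = iota (b / iter j sigma b) * x ^+ j * smono b v i.
Proof.
move=> b0; rewrite /smono -!mulrA (mulrA (x ^+ j)) xnC -!mulrA.
rewrite (mulrA (x ^+ j)) central_xn !mulrA -rmorphM divfK ?iter_sigma_eq0 //.
by rewrite -!mulrA -!exprD addnC.
Qed.

(** From x h = h c x the coefficients satisfy sigma(p_j) = p_j sigma^j(c). The support of p lies in
    one class modulo n, so sigma^j(c) is constant on it and each p_j over the leading coefficient is
    fixed by sigma, hence in K. *)
Lemma conj_smono h c : h \is a GRing.unit -> (exists i, homog i h) ->
  h^-1 * x * h = iota c * x ->
  exists b v (i : 'I_n), [/\ b != 0, v != 0 & h = smono b v i].
Proof.
move=> hU [i0 hi0] hc; pose i : 'I_n := Ordinal (ltn_pmod i0 n_gt0).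
have hi : homog i h by apply: homog_mod hi0; rewrite modn_mod.
have c0 : c != 0.
  apply: contraTneq isT => c0; move: hc; rewrite c0 rmorph0 mul0r.
  move=> /(congr1 (fun r => r \is a GRing.unit)).
  by rewrite !unitrMl ?unitrV // hU unitr0.
have {hc} hc : x * h = h * iota c * x by rewrite -mulrA -hc !mulrA divrr //
  mul1r.
have [p sp pE] := ev_onto h.
have p0 : p != 0.
  by apply: contraTneq hU => p0; rewrite pE p0 ev0 unitr0.
have cp j : sigma p`_j = p`_j * iter j sigma c.
  move: hc; rewrite pE -[x in LHS]expr1 xn_ev evMXn expr1 => /(mulIr xU).
  rewrite ev_iota => /ev_inj; rewrite size_twist => /(_ sp).
  rewrite (leq_trans (size_poly _ _)) // => /(_ isT)/(congr1 (coefp j)) /=.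
  rewrite coef_map coef_poly /= => ->; case: ltnP => // lej.
  by rewrite nth_default ?mul0r.
rewrite pE in hi.
have lp : lead_coef p != 0 by rewrite lead_coef_eq0.
set b := lead_coef p in lp; set d := (size p).-1 in b lp.
have pf j : exists t, p`_j / b = f t.
  apply: sigma_fixed; have [->|pj] := eqVneq p`_j 0;
    first by rewrite mul0r rmorph0.
  rewrite fmorph_div {2}/b /lead_coef !cp.
  have e a : iter j sigma a = iter d sigma a.
    by have [_] := sigma_iter j d; apply;
      rewrite (homog_coef sp hi pj) (homog_coef sp hi lp).
  rewrite e -mulf_div divff ?mulr1 //.
  by rewrite iter_sigma_eq0.
have [t tE] := fin_all_exists (fun k : 'I_s => pf (i + n * k)%N).
suff hE : h = smono b (\row_k t k) i.
  exists b, (\row_k t k), i; split=> //; apply: contraTneq hU => v0.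
  rewrite hE v0 /smono linear0 /central /central_poly rmorph0 comp_poly0 ev0.
  by rewrite mulr0 mul0r unitr0.
rewrite smono_ev pE; congr (ev _); apply/polyP => j; rewrite coef_smono //.
case: ifP => [/andP[ij /dvdnP[k kE]]|H].
  have jE : (j = i + n * k)%N by rewrite mulnC -kE subnKC.
  rewrite kE mulnK //; have [ks|sk] := ltnP k s; last first.
    rewrite !nth_default ?rmorph0 ?mulr0 // ?(leq_trans (size_poly _ _)) //.
    by rewrite (leq_trans sp) // jE (leq_trans _ (leq_addl _ _)) // leq_mul2l
      sk orbT.
  rewrite -[k]/(val (Ordinal ks)) coef_rVpoly_ord mxE -tE jE /=.
  by rewrite mulrC divfK.
apply/eqP; apply: contraFT H => pj; have e := homog_coef sp hi pj.
have : (i <= j)%N.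
  by rewrite -[nat_of_ord i](modn_small (ltn_ord i)) -e leq_mod.
move=> ij; rewrite ij /=; rewrite -eqn_mod_dvd //; exact/eqP.
Qed.

End BaseField.
End SkewCoordinates.

(** * The quotient ring and the count *)

Section SkewEmbedding.
Variables (L : fieldType) (sigma : {rmorphism L -> L}).

Fact skewC_zmod_morphism : zmod_morphism (@skewC L sigma).
Proof. by move=> a b; rewrite /skewC polyCB. Qed.

Fact skewC_monoid_morphism : monoid_morphism (@skewC L sigma).
Proof.
split=> // a b; apply/polyP => i.
by rewrite coef_skewCM !coefC; case: eqP; rewrite ?mulr0.
Qed.

HB.instance Definition _ := GRing.isZmodMorphism.Build L {skew sigma}
  (@skewC L sigma) skewC_zmod_morphism.
HB.instance Definition _ := GRing.isMonoidMorphism.Build L {skew sigma}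
  (@skewC L sigma) skewC_monoid_morphism.

Lemma coef_skew_sum m (a : 'I_m -> L) j :
  ((\sum_(i < m) (a i)%:S * skewX sigma ^+ i : {skew sigma}) : {poly L})`_j
    = if insub j is Some i then a i else 0.
Proof.
rewrite (big_morph (fun p : {skew sigma} => (p : {poly L})`_j)
  (id1 := 0) (op1 := +%R)); [|by move=> p q; rewrite coefD|by rewrite coef0].
under eq_bigr do rewrite coef_skew_mono.
case: insubP => [k _ <-|]; last rewrite -leqNgt => mj.
  rewrite (bigD1 k) //= eqxx big1 ?addr0 // => i.
  by rewrite -val_eqE eq_sym => /negPf /= ->.
by rewrite big1 // => i _; rewrite gtn_eqF // (leq_trans _ mj).
Qed.

End SkewEmbedding.

Section SkewCode.
Local Open Scope quotient_scope.
Variables (Fq : finFieldType) (L : splittingFieldType Fq).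
Variables (sigma : gal_of {:L}) (F : {poly Fq}) (Firr : irreducible_poly F).

Local Notation R := {skew sigma}.
Local Notation RF := (skew_quot sigma Firr).
Local Notation n := (\dim {:L}).
Local Notation s := (size F).-1.

Definition quot_iota (a : L) : RF := \pi_RF (skewC sigma a).

Fact quot_iota_zmod_morphism : zmod_morphism quot_iota.
Proof. by move=> a b; rewrite /quot_iota rmorphB pi_skew_quot_zmod_morphism.
  Qed.

Fact quot_iota_monoid_morphism : monoid_morphism quot_iota.
Proof.
have [pi1 piM] := pi_skew_quot_monoid_morphism sigma Firr.
by split=> [|a b]; rewrite /quot_iota ?rmorph1 ?rmorphM.
Qed.

HB.instance Definition _ := GRing.isZmodMorphism.Build L RF
  quot_iota quot_iota_zmod_morphism.
HB.instance Definition _ := GRing.isMonoidMorphism.Build L RF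
  quot_iota quot_iota_monoid_morphism.

Definition quot_x : RF := \pi_RF (skewX sigma).
Lemma pi_skew_quotM (p q : R) : \pi_RF (p * q) = \pi_RF p * \pi_RF q.
Proof. exact: (pi_skew_quot_monoid_morphism sigma Firr).2. Qed.

Lemma pi_skew_quotXn (p : R) i : \pi_RF (p ^+ i) = \pi_RF p ^+ i.
Proof.
elim: i => [|i IHi]; first exact: (pi_skew_quot_monoid_morphism sigma Firr).1.
by rewrite !exprS pi_skew_quotM IHi.
Qed.

Lemma quot_xC a : quot_x * quot_iota a = quot_iota (sigma a) * quot_x.
Proof. by rewrite /quot_x /quot_iota -!pi_skew_quotM skewXC. Qed.

(** Evaluation in R_F is the canonical projection read on coefficients; through it the hypotheses on
    [ev] are verified. *)
Lemma quot_ev (p : {poly L}) : ev quot_iota quot_x p = \pi_RF (p : R).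
Proof.
rewrite (evE _ _ (leqnn _)).
transitivity (\pi_RF (\sum_(i < size p) (p`_i)%:S * skewX sigma ^+ i : R)).
  rewrite (big_morph _ (@pi_skew_quotD _ _ sigma _ Firr)
    (@pi_skew_quot0 _ _ sigma _ Firr)).
  by apply: eq_bigr => i _; rewrite pi_skew_quotM pi_skew_quotXn.
congr (\pi_RF _); apply/polyP => j; rewrite coef_skew_sum.
by case: insubP => [i _ <- //|]; rewrite -leqNgt => ?; rewrite nth_default.
Qed.

Local Notation "''ev' p" := (ev quot_iota quot_x p) (at level 10, p at level 8).

(** A nonzero multiple of F(X^n) has degree at least ns. *)
Lemma quot_ev_eq0 (p : {poly L}) : (size p <= n * s)%N -> 'ev p = 0 -> p = 0.
Proof.
move=> sp; rewrite quot_ev -(@pi_skew_quot0 _ _ sigma _ Firr) =>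
  /eqP/eq_skew_quotP[r].
rewrite subr0 => pr; have [r0|r0] := eqVneq r 0; first by rewrite pr r0 mul0r.
have := coef_mul_skewFXn F r0; rewrite -pr nth_default; last first.
  exact: leq_trans sp (leq_addl _ _).
move/esym/eqP; rewrite mulf_eq0 lead_coef_eq0 (negPf r0) scaler_eq0 oner_eq0
  orbF.
by rewrite lead_coef_eq0 => /eqP F0; case: Firr => + _; rewrite F0 size_poly0.
Qed.

Lemma quot_ev_onto (r : RF) : exists2 p : {poly L}, (size p <= n * s)%N &
  r = 'ev p.
Proof.
have [q sq /eqP rq] := skew_quot_small Firr (generic_quotient.repr r).
by exists q => //; rewrite quot_ev -rq reprK.
Qed.

Hypothesis hsigma : generator 'Gal({:L} / 1%AS) sigma.

Lemma gal_iter m a : iter m sigma a = (sigma ^+ m)%g a.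
Proof. by elim: m => [|m IHm]; rewrite ?gal_id // expgSr galM ?memvf // -IHm.
  Qed.

Lemma gal_in_alg (t : Fq) : sigma (in_alg L t) = in_alg L t.
Proof. exact: iter_sigma_alg sigma 1 t. Qed.

Lemma gal_generator_order : #[sigma]%g = n.
Proof.
rewrite /order -(eqP hsigma) -galois_dim ?finField_galois ?sub1v //.
by rewrite dimv1 divn1.
Qed.

Lemma gal_generator_iter i j :
  (forall a, iter i sigma a = iter j sigma a) <-> (i = j %[mod n])%N.
Proof.
have := eq_expg_mod_order sigma i j; rewrite gal_generator_order => e.
split=> [H|/eqP]; last by rewrite -e => /eqP e' a; rewrite !gal_iter e'.
by apply/eqP; rewrite -e; apply/gal_eqP => a _; rewrite -!gal_iter.
Qed.

Lemma gal_generator_fixed a : sigma a = a -> exists t : Fq, a = in_alg L t.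
Proof.
move=> sa; have : a \in fixedField 'Gal({:L} / 1%AS)%g.
  apply/fixedFieldP; first exact: memvf.
  rewrite (eqP hsigma) => _ /cycleP[i ->].
  by rewrite -gal_iter; elim: i => //= i ->.
have /galois_fixedField -> : galois 1%AS {:L} by rewrite finField_galois ?sub1v.
by move=> /vlineP[t ->]; exists t.
Qed.

Hypotheses (n_gt1 : (1 < n)%N) (s_gt1 : (1 < s)%N).

Lemma quot_scalarF : central quot_iota quot_x n (in_alg L) F = 0.
Proof.
rewrite /central quot_ev -(@pi_skew_quot0 _ _ sigma _ Firr);
  apply/eqP/eq_skew_quotP.
exists 1; rewrite subr0 mul1r; apply/polyP => i.
by rewrite coef_central_poly // coef_skewFXn.
Qed.

(** It suffices that x^n is a unit: F is irreducible of degree s > 1, hence coprime to Y. *)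
Lemma quot_xU : quot_x \is a GRing.unit.
Proof.
rewrite -(unitrX_pos _ (n_gt0 L)).
have -> : quot_x ^+ n = central quot_iota quot_x n (in_alg L) 'X.
  by rewrite -['X]mul1r centralMX central1 mul1r.
apply: (central_unit quot_xC gal_generator_iter quot_ev_onto Firr quot_scalarF).
  by rewrite polyX_eq0.
by rewrite size_polyX -ltn_predRL.
Qed.

Variable k : nat.
Hypothesis hk : (1 <= k <= n - 1)%N.

Lemma skew_codeP c : reflect (low quot_iota quot_x (s * k) c)
  (c \in skew_code sigma Firr k).
Proof.
rewrite inE; apply: (iffP (asboolP _)) => [[a ->]|[p sp ->]].
  exists (\poly_(i < s * k) if insub i is Some j then a j else 0).
    exact: size_poly.
  rewrite quot_ev; congr (\pi_RF _); apply/polyP => j; rewrite coef_poly.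
  rewrite [LHS]coef_skew_sum; case: insubP => [i -> _ //|/negPf -> //].
exists (fun i => p`_i); rewrite quot_ev; congr (\pi_RF _); apply/polyP => j.
rewrite [RHS]coef_skew_sum; case: insubP => [i _ <- //|]; rewrite -leqNgt => ?.
by rewrite nth_default // (leq_trans sp).
Qed.


Let ks_gt1 : (1 < s * k)%N.
Proof. by case/andP: hk => k1 _; rewrite (leq_trans s_gt1) // leq_pmulr. Qed.

Let ks_lt : (s * k + 1 < n * s)%N.
Proof.
case/andP: hk => _ kn; rewrite [(n * s)%N]mulnC.
have : (s * k <= s * (n - 1))%N by rewrite leq_mul2l kn orbT.
have : (s <= s * n)%N by rewrite leq_pmulr // ltnW.
by rewrite mulnBr muln1; move: s_gt1; move: (s * k)%N (s * n)%N; clear; lia.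
Qed.

(** * Counting the units b z(x^n) x^i *)

Definition quot_smono (t : finvect_type L * 'rV[Fq]_s * 'I_n) : RF :=
  smono quot_iota quot_x n (in_alg L) t.1.1 t.1.2 t.2.

Definition smono_params : {set finvect_type L * 'rV[Fq]_s * 'I_n} :=
  setX (setX [set~ 0] [set~ 0]) setT.

Lemma smono_paramsP t : reflect (t.1.1 != 0 /\ t.1.2 != 0) (t \in smono_params).
Proof. by rewrite !inE andbT; apply: andP. Qed.

Lemma quot_smono_unit t : t \in smono_params -> quot_smono t \is a GRing.unit.
Proof.
move=> /smono_paramsP[b0 v0].
apply: (smono_unit quot_xU quot_xC gal_generator_iter quot_ev_onto _ Firr
  quot_scalarF) => //.
by rewrite prednK //; move: s_gt1; lia.
Qed.

Lemma card_finvect : #|finvect_type L| = (#|Fq| ^ n)%N.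
Proof. by rewrite -(card_vspacef (Vector.class (finvect_type L))) card_vspace.
  Qed.

Lemma card_smono_params :
  #|smono_params| = ((#|Fq| ^ n - 1) * (#|Fq| ^ s - 1) * n)%N.
Proof.
by rewrite !cardsX !cardsC1 cardsT card_ord card_mx mul1n card_finvect !subn1.
Qed.

(** The nonzero c in [Fq] act on the parameters by (b, v) -> (b / c, c v), freely since v is
    nonzero, and the orbits are the fibres of [quot_smono]. *)
Lemma card_smono :
  (#|quot_smono @: smono_params| * (#|Fq| - 1))%N = #|smono_params|.
Proof.
rewrite -[RHS]sum1_card.
rewrite (partition_big_imset quot_smono) /= -sum_nat_const.
apply: eq_bigr => r /imsetP[[[b v] i] /[dup] tT /smono_paramsP[/= b0 v0] ->].
pose h (c : Fq) : finvect_type L * 'rV[Fq]_s * 'I_n :=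
  ((b : L) / in_alg L c, c *: v, i).
have h_inj : injective h.
  move=> c c' [_ e]; apply/eqP; rewrite -subr_eq0.
  have : (c - c') *: v == 0 by rewrite scalerBl e subrr.
  by rewrite scaler_eq0 (negPf v0) orbF.
rewrite sum1_card subn1 -(cardsC1 (0 : Fq)) -(card_imset _ h_inj).
apply: eq_card => t; apply/imsetP/andP.
  move=> [c + ->]; rewrite in_setC1 => c0; split.
    apply/(smono_paramsP (h c)); split; last by rewrite scaler_eq0 negb_or c0.
    have c0' : (in_alg L c)^-1 != 0 by rewrite invr_neq0 ?fmorph_eq0.
    exact: (mulf_neq0 (b0 : (b : L) != 0) c0').
  by apply/eqP; apply: smono_scale.
case: t => [[b' v'] i'] [/smono_paramsP[/= b0' v0'] /eqP/esym e].
have [ii [c c0 [bE vE]]] := smono_eq n_gt1 quot_xU quot_ev_eq0 (ltn_ord i)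
  (ltn_ord i') b0 v0 b0' v0' e.
by exists c; rewrite ?inE // /h -bE -vE; congr (_, _, _); apply: val_inj.
Qed.

(** * The excluded case and the order of the group *)

Hypothesis Fexc : forall nu : Fq, nu != 0 ->
  (n, s, F) <> (2%N, 2%N, 'X^2 - nu%:P).
Hypothesis Fmonic : F \is monic.

(** For s > 2, X^4 and c are distinct representatives of degree < ns. For s = 2, c - X^4 + F(X^2)
    has degree < ns because F is monic, so it vanishes; thus F = Y^2 - nu, and nu is nonzero because
    Y^2 is reducible. *)
Lemma no_exception : ~ (n = 2%N /\ exists c, quot_x ^+ 4 = quot_iota c).
Proof.
move=> [n2 [c]]; rewrite -(evXn quot_iota) -(evC quot_iota quot_x) => e.
have [s2|s2] := eqVneq s 2%N; last first.
  have s3 : (2 < s)%N by rewrite ltn_neqAle eq_sym s2.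
  have /(congr1 (coefp 4)) : 'X^4 = c%:P.
    apply: (ev_inj quot_ev_eq0 _ _ e); rewrite n2.
      by rewrite size_polyXn; move: s s3; lia.
    by rewrite (leq_trans (size_polyC_leq1 _)) //; move: s s3; lia.
  by rewrite /= coefXn coefC /= => /eqP; rewrite oner_eq0.
have sF : size F = 3 by rewrite -[size F]prednK ?s2 //
  (leq_trans _ (leq_pred _)) // s2.
have F2 : F`_2 = 1 by move/monicP: Fmonic; rewrite /lead_coef sF.
pose p := c%:P - 'X^4 + central_poly n (in_alg L) F.
have pE j : p`_j = c *+ (j == 0%N) - (j == 4%N)%:R
    + (if (2 %| j)%N then (F`_(j %/ 2))%:A else 0).
  by rewrite !coefD coefN coefC coefXn coef_central_poly // n2; case: (j).
have p0 : p = 0.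
  apply: quot_ev_eq0; last first.
    by rewrite evD evB -e subrr add0r; apply: quot_scalarF.
  rewrite n2 s2; apply/leq_sizeP => j; rewrite leq_eqVlt => /predU1P[<-|j4].
    by rewrite pE /= F2 scale1r add0r addNr.
  rewrite pE; have [-> ->] : (j == 0)%N = false /\ (j == 4)%N = false by split;
    lia.
  rewrite subr0 add0r; case: ifP => // /dvdnP[l jE].
  by rewrite jE mulnK // nth_default ?scale0r // sF; lia.
have F1 : F`_1 = 0.
  have := pE 2%N; rewrite p0 coef0 /= subr0 add0r => /esym/eqP.
  by rewrite scaler_eq0 oner_eq0 orbF => /eqP.
have FE : F = 'X^2 - (- F`_0)%:P.
  apply/polyP => -[|[|[|j]]]; rewrite coefB coefXn coefC /= ?subr0 ?sub0r
    ?opprK //.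
  by rewrite nth_default // sF.
have F0 : F`_0 != 0.
  apply/eqP => F0; have [_ /(_ 'X)] := Firr; rewrite size_polyX => /(_ isT).
  rewrite {1}FE F0 oppr0 subr0 (dvdp_mulr 'X (dvdpp 'X)) => /(_ isT)/eqp_size.
  by rewrite size_polyX sF.
by apply: (Fexc (nu := - F`_0)); rewrite ?oppr_eq0 // n2 s2 -FE.
Qed.

Lemma skew_code_autP (gh : {unit RF} * {unit RF}) :
  gh \in skew_code_aut sigma Firr k <->
  exists2 c : L, c != 0 & exists2 t, t \in smono_params &
    val gh.1 * val gh.2 = quot_iota c /\ val gh.2 = quot_smono t.
Proof.
set g := val gh.1; set h := val gh.2.
have gU : g \is a GRing.unit by exact: valP.
have hU : h \is a GRing.unit by exact: valP.
have actI : injective (fun c => g * c * h) by move=> c c'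
  /(mulIr hU)/(mulrI gU).
split; last first.
  (* The map r -> g r h is injective and S is finite, so one inclusion gives equality. *)
  move=> [c c0 [t /smono_paramsP[b0 v0] [gh_c h_t]]]; rewrite inE eqEcard.
  rewrite card_imset // leqnn andbT; apply/subsetP => _
    /imsetP[r /skew_codeP rS ->].
  apply/skew_codeP.
  have [r' r'S e] := low_smono n_gt1 quot_xC gal_generator_iter gal_in_alg
    t.1.2 t.2 b0 rS.
  rewrite -/g -/h -mulrA h_t /quot_smono e mulrA -/(quot_smono t) -h_t gh_c.
  exact: low_iota.
rewrite inE => /eqP aut.
have lo r : low quot_iota quot_x (s * k) r -> low quot_iota quot_x (s * k)
  (g * r * h).
  by move=> /skew_codeP rS; apply/skew_codeP; rewrite -aut; apply: imset_f.
have loV r : low quot_iota quot_x (s * k) r -> low quot_iota quot_x (s * k)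
  (g^-1 * r * h^-1).
  move=> /skew_codeP; rewrite -aut => /imsetP[r' /skew_codeP r'S ->].
  by rewrite !mulrA mulVr // mul1r mulrK.
have [[c hc]|//] := aut_conj_cases n_gt1 quot_xU quot_xC gal_generator_iter
  quot_ev_eq0 quot_ev_onto ks_gt1 ks_lt gU hU lo loV; last by move/no_exception.
have hh := aut_homogr n_gt1 quot_xU quot_xC 
  quot_ev_eq0 quot_ev_onto ks_gt1 ks_lt gU hU lo loV.
have [b [v [i [b0 v0 hE]]]] := conj_smono n_gt1 quot_xU quot_xC
  gal_generator_iter
  quot_ev_eq0 quot_ev_onto gal_generator_fixed hU hh hc.
(* h x^j is a scalar times x^j h, so g h x^j lies in g S h = S; hence g h is a scalar. *)
have [|||a aE] := @low_stab1 _ sigma _ quot_iota quot_x n s n_gt1 quot_xU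
  quot_xC quot_ev_eq0 (s * k) (g * h).
- by move: ks_gt1 ks_lt; lia.
- by rewrite -[g]mulr1 -(expr0 quot_x); apply/lo/low_xn; exact: ltnW.
- move=> j jk; left; rewrite hE -mulrA (smono_xn n_gt1 quot_xC gal_in_alg) //
  mulrA -hE.
  exact/lo/low_mono.
exists a.
  apply: contraTneq (_ : g * h \is a GRing.unit); last by rewrite unitrMl.
  by rewrite aE => ->; rewrite rmorph0 unitr0.
exists ((b, v, i) : finvect_type L * 'rV[Fq]_s * 'I_n) => //.
by apply/smono_paramsP.
Qed.

(** The injection (g, h) -> (g h, h) maps the group onto the product of the nonzero scalars of L
    with the set of units [quot_smono t]. *)
Lemma card_skew_code_aut : #|skew_code_aut sigma Firr k| =
  ((#|Fq| ^ n - 1) * #|quot_smono @: smono_params|)%N.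
Proof.
pose psi (gh : {unit RF} * {unit RF}) : RF * RF :=
  (val gh.1 * val gh.2, val gh.2).
have psi_inj : injective psi.
  move=> [g h] [g' h'] [/= e /val_inj eh]; rewrite eh in e *.
  by congr (_, _); apply/val_inj/(mulIr (valP h')).
have iota_I : injective (fun a : finvect_type L => quot_iota a).
  exact: (iota_inj n_gt1 quot_ev_eq0 (ltnW s_gt1)).
rewrite -(card_imset _ psi_inj) -card_finvect subn1
  -(cardsC1 (0 : finvect_type L)).
rewrite -(card_imset _ iota_I) -cardsX; apply: eq_card => -[c h].
rewrite in_setX; apply/imsetP/andP =>
  [[gh /skew_code_autP[a a0 [t tT [e1 e2]]] [-> ->]]|].
  split; last by rewrite e2; apply: imset_f.
  rewrite e1; apply: (imset_f (fun a : finvect_type L => quot_iota a)).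
  by rewrite !inE.
move=> [/imsetP[a +] -> /imsetP[t tT ->]]; rewrite !inE => a0.
have hU := quot_smono_unit tT.
have aU : quot_iota a \is a GRing.unit by rewrite rmorph_unit ?unitfE.
have gU : quot_iota a / quot_smono t \is a GRing.unit.
  by rewrite unitrMl ?unitrV.
exists (FinRing.unit _ gU, FinRing.unit _ hU); last by rewrite /psi /= divrK.
by apply/skew_code_autP; exists a => //; exists t => //=; rewrite divrK.
Qed.

End SkewCode.

Theorem corollary6p7 (q n s k : nat) (Fq : finFieldType)
    (L : splittingFieldType Fq) (sigma : gal_of {:L}) (F : {poly Fq})
    (hq : #|Fq| = q) (hL : (\dim {:L})%N = n)
    (hn : (2 <= n)%N) (hs : (2 <= s)%N) (hk : (1 <= k <= n - 1)%N)
    (hsigma : generator 'Gal({:L} / 1%AS) sigma)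
    (Fmonic : F \is monic) (Firr : irreducible_poly F) (Fdeg : size F = s.+1)
    (Fexc : forall nu : Fq, nu != 0 ->
       (n, s, F) <> (2%N, 2%N, 'X^2 - nu%:P)) :
  #|skew_code_aut sigma Firr k|%:R =
    n%:R * (((q%:R ^+ s - 1) * (q%:R ^+ n - 1) ^+ 2) / (q%:R - 1)) :> rat.
Proof.
have sE : s = (size F).-1 by rewrite Fdeg.
have q1 : (1 < q)%N by rewrite -hq card_finNzRing_gt1.
have qX i : (0 < i)%N -> (q ^ i - 1)%:R = q%:R ^+ i - 1 :> rat.
  by move=> i0; rewrite natrB ?natrX // expn_gt0 ltnW.
have [hk' hn' hs'] :
  [/\ (1 <= k <= \dim {:L} - 1)%N, (1 < \dim {:L})%N & (1 < (size F).-1)%N].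
  by rewrite hL -sE.
rewrite sE -hL in Fexc.
have := card_skew_code_aut Firr hsigma hn' hs' hk' Fexc Fmonic.
have := card_smono Firr hsigma hn' hs'; rewrite card_smono_params.
move: #|[set quot_smono sigma Firr t | t in smono_params L F]| => N.
rewrite -sE hL hq => /(congr1 (fun m => m%:R : rat)) + ->.
have q1E : (q - 1)%:R = q%:R - 1 :> rat by rewrite natrB // ltnW.
have q_neq1 : q%:R - 1 != 0 :> rat.
  by rewrite -q1E Num.Theory.pnatr_eq0 subn_eq0 -ltnNge.
rewrite !natrM !qX ?(ltnW hn) ?(ltnW hs) // q1E => NE.
(* N is known through N (q - 1) = (q^n - 1)(q^s - 1) n, so both sides are multiplied by q - 1. *)
apply: (mulIf q_neq1); rewrite -[LHS]mulrA NE -[RHS]mulrA divfK //; ring.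
Qed.
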